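(* Fix open-loop controls $\alpha(t)$ and $R(t)$, $t\in[0,T]$. Let $x(t)$ be the nominal trajectory of the controlled traffic dynamics with initial traffic volume $x^0$ and inflow $\lambda(t)$, and let $\tilde x(t)$ be the perturbed trajectory, under the same controls $\alpha(t),R(t)$, with initial traffic volume $\tilde x^0$ and inflow $\tilde\lambda(t)$. If the perturbations $\|\tilde x^0-x^0\|_1$ and $\|\tilde\lambda-\lambda\|_{1,T}$ are sufficiently small, in the sense that $x(t)$ and $\tilde x(t)$ remain in the free-flow region for all $t\in[0,T]$, then $$\|\tilde x(t)-x(t)\|_1\le\|\tilde x^0-x^0\|_1+\|\tilde\lambda-\lambda\|_{1,t},\qquad \forall\,t\in[0,T].$$
   Context: **Network.** $\mathcal G=(\mathcal V,\mathcal E)$ is a finite directed multigraph whose links $i\in\mathcal E$ are called cells; cell $i$ is directed from $\sigma_i$ to $\tau_i$. A distinguished node $w\in\mathcal V$ represents the external world. $\mathcal R=\{i:\sigma_i=w\}$ is the set of sources, $\mathcal S=\{i:\tau_i=w\}$ the set of sinks, and $\mathcal A=\{(i,j)\in\mathcal E\times\mathcal E:\tau_i=\sigma_j\ne w\}$. **Cells.** For each $i\in\mathcal E$: $d_i:[0,\infty)\to[0,\infty)$ is continuous, non-decreasing, concave, with $d_i(0)=0$; $C_i=C_i(t)\ge 0$ is the flow capacity. For $i\in\mathcal E\setminus\mathcal R$ the supply function $s_i$ is continuous, non-increasing, concave, with $s_i(0)>0$; for $i\in\mathcal R$, $s_i\equiv+\infty$. With demand control parameters $\alpha_i=\alpha_i(t)\in[0,1]$,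 $$\overline d_i(x_i,\alpha_i)=\min\{\alpha_i d_i(x_i),C_i\}\ (i\in\mathcal E\setminus\mathcal R),\qquad \overline d_i(x_i,\alpha_i)=\min\{d_i(x_i),\alpha_iC_i\}\ (i\in\mathcal R).$$ **Routing.** $R=R(t)$ is a nonnegative $\mathcal E\times\mathcal E$ matrix with $R_{ij}=0$ for $(i,j)\notin\mathcal A$ and $\sum_jR_{ij}=1$ for $i\in\mathcal E\setminus\mathcal S$. **Controlled traffic dynamics.** Given initial volumes $x^0\in\mathbb R_+^{\mathcal E}$ and inflows $\lambda(t)$ with $\lambda_i(t)\ge0$ for $i\in\mathcal R$ and $\lambda_i\equiv0$ for $i\notin\mathcal R$, the trajectory $x(t)$ solves $$\dot x_i=\lambda_i(t)+g_i(x,\alpha,R),\qquad g_i(x,\alpha,R)=\sum_{j\in\mathcal E}R_{ji}z_j-z_i,\qquad x_i(0)=x_i^0,\qquad i\in\mathcal E,$$ where $z_i=\overline d_i(x_i,\alpha_i)$ for $i\in\mathcal S$, and $z_i=\gamma_i^F\overline d_i(x_i,\alpha_i)$ for $i\in\mathcal E\setminus\mathcal S$ with $$\gamma_i^F=\sup\Big\{\gamma\in[0,1]:\ \gamma\sum_{h\in\mathcal E}R_{hk}\overline d_h(x_h,\alpha_h)\le s_k(x_k)\ \text{ for all }k\text{ with }(i,k)\in\mathcal A\Big\}.$$ **Free-flow region.** $x(t)$ is in the free-flow region at time $t$ if $x(t)\in\mathbb R_+^{\mathcal E}$ and $\sum_{i\in\mathcal E}R_{ij}(t)\overline d_i(x_i(t),\alpha_i(t))\le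 s_j(x_j(t))$ for all $j\in\mathcal E$. **Norms.** $\|v\|_1=\sum_i|v_i|$ and $\|\lambda-\tilde\lambda\|_{1,t}=\int_0^t\|\lambda(s)-\tilde\lambda(s)\|_1\,ds$. *)

(* Defs.v *)
From HB Require Import structures.
From mathcomp Require Import all_boot all_order all_algebra.
From mathcomp Require Import all_classical all_reals all_analysis.

Set Implicit Arguments.
Unset Strict Implicit.
Unset Printing Implicit Defensive.

Import Order.TTheory GRing.Theory Num.Theory.
Import numFieldNormedType.Exports.

Local Open Scope classical_set_scope.
Local Open Scope ring_scope.

Record network := Network {
  node : finType;
  cell : finType;
  tail : cell -> node;
  head : cell -> node;
  world : node }.

Section network.
Variable N : network.

Definition source (i : cell N) : bool := tail i == world N.
Definition sink (i : cell N) : bool := head i == world N.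
Definition linked (i j : cell N) : bool :=
  (head i == tail j) && (tail j != world N).

End network.

Section traffic.
Variables (R : realType) (N : network).
Local Notation mu := (@lebesgue_measure R).
Local Notation halfline := (`[0, +oo[%classic : set R).

Definition demand_function (d : R -> R) : Prop :=
  [/\ forall y : R, 0 <= y -> 0 <= d y,
      {within halfline, continuous d},
      {in `[0, +oo[ &, {homo d : y z / y <= z}},
      convex_function (halfline : set R^o) (\- d : R^o -> R^o) &
      d 0 = 0].

Definition supply_function (s : R -> R) : Prop :=
  [/\ {within halfline, continuous s},
      {in `[0, +oo[ &, {homo s : y z /~ y <= z}},
      convex_function (halfline : set R^o) (\- s : R^o -> R^o) &
      0 < s 0].

(* The real function [s i] is relevant only when [i] is not a source. *)
Definition supply (s : cell N -> R -> R) (i : cell N) (y : R) : \bar R :=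
  if source i then +oo%E else (s i y)%:E.

Definition routing_matrix (P : cell N -> cell N -> R) : Prop :=
  [/\ forall i j, 0 <= P i j,
      forall i j, ~~ linked i j -> P i j = 0 &
      forall i, ~~ sink i -> \sum_j P i j = 1].

Section dynamics.
Variables d s : cell N -> R -> R.
Variables (C alpha : cell N -> R) (P : cell N -> cell N -> R).
Implicit Types x : cell N -> R.

Definition controlled_demand x (i : cell N) : R :=
  if source i then Num.min (d i (x i)) (alpha i * C i)
  else Num.min (alpha i * d i (x i)) (C i).

Definition inflow_demand x (k : cell N) : R :=
  \sum_h P h k * controlled_demand x h.

(* [sup set0 = 0], which is also the supremum of the empty subset of [0, 1]. *)
Definition fifo_factor x (i : cell N) : R :=
  sup [set c : R | 0 <= c <= 1 /\
    forall k, linked i k ->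
      ((c * inflow_demand x k)%:E <= supply s k (x k))%E].

Definition outflow x (i : cell N) : R :=
  if sink i then controlled_demand x i
  else fifo_factor x i * controlled_demand x i.

Definition net_flow x (i : cell N) : R :=
  \sum_j P j i * outflow x j - outflow x i.

Definition free_flow x : Prop :=
  (forall i, 0 <= x i) /\
  (forall j, ((inflow_demand x j)%:E <= supply s j (x j))%E).

End dynamics.

Definition inflow_function (T : R) (lam : R -> cell N -> R) : Prop :=
  [/\ forall i, measurable_fun (`[0, T]%classic : set R) (lam ^~ i),
      forall (t : R) i, t \in `[0, T] -> source i -> 0 <= lam t i &
      forall (t : R) i, t \in `[0, T] -> ~~ source i -> lam t i = 0].

Definition absolutely_continuous (a b : R) (f : R -> R) : Prop :=
  forall e : R, 0 < e -> exists2 del : R, 0 < del &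
    forall (n : nat) (u v : 'I_n -> R),
      (forall k, a <= u k /\ u k <= v k /\ v k <= b) ->
      trivIset setT (fun k => `]u k, v k[%classic : set R) ->
      \sum_k (v k - u k) < del ->
      \sum_k `|f (v k) - f (u k)| < e.

(* Since the controls and the inflows need not be continuous in time, solutions
   are understood in the sense of Caratheodory. *)
Definition trajectory (T : R) (d s : cell N -> R -> R)
    (C alpha : R -> cell N -> R) (P : R -> cell N -> cell N -> R)
    (x0 : cell N -> R) (lam x : R -> cell N -> R) : Prop :=
  forall i,
    [/\ absolutely_continuous 0 T (x ^~ i),
        {ae mu, forall t : R, t \in `]0, T[ ->
          is_derive t 1 (x ^~ i : R^o -> R^o)
            (lam t i + net_flow d s (C t) (alpha t) (P t) (x t) i)} &
        x 0 i = x0 i].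

Definition norm1 (v : cell N -> R) : R := \sum_i `|v i|.

Definition norm1_upto (t : R) (lam : R -> cell N -> R) : \bar R :=
  (\int[mu]_(r in `[0%R, t]) (norm1 (lam r))%:E)%E.

End traffic.

(* Main.v *)
Require Import Defs.
From mathcomp Require Import all_boot all_order all_algebra.
From mathcomp Require Import all_classical all_reals all_analysis.
From mathcomp Require Import measurable_realfun ring lra.

Set Implicit Arguments.
Unset Strict Implicit.
Unset Printing Implicit Defensive.

Import Order.TTheory GRing.Theory Num.Theory.
Import numFieldNormedType.Exports.

Local Open Scope classical_set_scope.
Local Open Scope ring_scope.

(** In free flow the FIFO factors equal 1, so the outflow of a cell is its
controlled demand, which is nondecreasing in the volume of that cell alone.
Routing only redistributes outflow, so the dynamics are monotone and lose mass
only through the sinks; this makes them an l1-contraction. Write y = x' - x,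
and let z be the difference of the controlled demands. The difference of the
two equations reads

  y_i' = (lam'_i - lam_i) + sum_j P_ji z_j - z_i,

where z_i * y_i >= 0, and z_i vanishes when y_i does. Hence |y_i| grows at
rate at most |lam'_i - lam_i| + sum_j P_ji |z_j| - |z_i|, even where y_i
vanishes, and the sum over i of these bounds is at most the l1 norm of
lam' - lam because the rows of P sum to at most 1 ([free_flow_contraction]).

It remains to integrate this rate, which is available almost everywhere only.
The growth of a function near a point c is measured by its increments over
small intervals straddling c ([straddle_le]), a notion that is additive and
that applies to |y_i| at the zeros of y_i. If f is absolutely continuous, G is
nondecreasing and f - G has growth rate at most 0, in this sense, at every c
outside a null set E, then f b - f a <= G b - G a
([absolutely_continuous_le]): cover E by an open set U of small measure and
chain straddling intervals from a to b; those that straddle a point of E can be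
taken inside U, where absolute continuity makes their total contribution to f
small, while G only gains. With G the indefinite integral of the norm of
lam' - lam, differentiable almost everywhere by the Lebesgue differentiation
theorem, this is the claimed estimate. When that integral is infinite there is
nothing to prove. *)

(** * Growth rates on straddling intervals *)

(** Cousin's compactness argument: a property [Q] of the right endpoint that is
transported by [L] along adjacent intervals reaches [b] as soon as every point
[c] has a neighbourhood in which [L] holds on all intervals straddling [c]. *)
Lemma segment_straddle_ind (R : realType) (a b : R) (Q : R -> Prop)
    (L : R -> R -> Prop) :
  a <= b -> Q a ->
  (forall u v, a <= u -> u <= v -> v <= b -> Q u -> L u v -> Q v) ->
  (forall c, a <= c <= b -> exists2 e, 0 < e & forall u v,
     a <= u <= c -> c <= v <= b -> c - e < u -> v < c + e -> L u v) ->
  Q b.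
Proof.
move=> ab Qa step loc.
pose S := [set t : R | a <= t <= b /\ Q t].
have Sa : S a by split; rewrite ?lexx.
have Sb : ubound S b by move=> t [/andP[]].
have supS : has_sup S by split; [exists a | exists b].
have ac : a <= sup S by exact: sup_upper_bound.
have cb : sup S <= b by apply: ge_sup Sb; exact: supS.1.
have [|e e0 cL] := loc (sup S); first by rewrite ac.
have [u [/andP[au ub] Qu] cu] := sup_adherent e0 supS.
have uc : u <= sup S by apply: sup_upper_bound => //; split; rewrite ?au.
(* A step across [sup S] reaches past it, unless it is stopped by [b]. *)
pose v := Num.min b (sup S + e / 2).
have cv : sup S <= v by rewrite le_min cb/= lerDl divr_ge0// ltW.
have vb : v <= b by rewrite ge_min lexx.
have vlt : v < sup S + e.
  by rewrite gt_min ltrD2l ltr_pdivrMr// ltr_pMr// ltr1n orbT.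
have Qv : Q v.
  apply: (step u) => //; first exact: le_trans cv.
  by apply: cL => //; rewrite ?au ?cv.
have vc : v <= sup S.
  by apply: sup_upper_bound => //; split; rewrite ?vb ?andbT// (le_trans ac).
move: vc Qv; rewrite /v /Num.min; case: ifP => // _.
by rewrite gerDl leNgt divr_gt0.
Qed.

(** [straddle_le f c m]: at [c], the function [f] grows at rate at most [m], in
the sense that its increment over a small interval [u, v] containing [c] is at
most [(m + eps) * (v - u)]. If [f] is differentiable at [c], its derivative is
such an [m]; unlike a derivative, this bound also makes sense at a corner. *)
Definition straddle_le (R : realType) (f : R -> R) (c m : R) : Prop :=
  forall eps, 0 < eps -> exists2 e, 0 < e & forall u v,
    u <= c <= v -> c - e < u -> v < c + e -> f v - f u <= (m + eps) * (v - u).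

Lemma straddle_leW (R : realType) (f : R -> R) (c m m' : R) :
  m <= m' -> straddle_le f c m -> straddle_le f c m'.
Proof.
move=> mm' fm eps /fm[e e0 h]; exists e => // u v ucv cu vc.
apply: le_trans (h _ _ ucv cu vc) _; apply: ler_wpM2r; last by rewrite lerD2r.
by move: ucv => /andP[uc cv]; rewrite subr_ge0 (le_trans uc).
Qed.

Lemma straddle_leD (R : realType) (f g : R -> R) (c m n : R) :
  straddle_le f c m -> straddle_le g c n ->
  straddle_le (f \+ g) c (m + n).
Proof.
move=> fm gn eps eps0; have eps2 : 0 < eps / 2 by rewrite divr_gt0.
have [e e0 hf] := fm _ eps2; have [e' e'0 hg] := gn _ eps2.
exists (Num.min e e') => [|u v ucv]; first by rewrite lt_min e0.
rewrite ltrBlDr -ltrBlDl lt_min => /andP[h1 h2].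
rewrite -ltrBlDl lt_min => /andP[h3 h4] /=.
have := hf u v ucv _ _; have := hg u v ucv _ _.
move=> /(_ ltac:(lra) ltac:(lra)) G /(_ ltac:(lra) ltac:(lra)) F.
lra.
Qed.

Lemma straddle_le_sum (R : realType) (I : finType) (f : I -> R -> R) (c : R)
    (m : I -> R) :
  (forall i, straddle_le (f i) c (m i)) ->
  straddle_le (fun t => \sum_i f i t) c (\sum_i m i).
Proof.
move=> fm; rewrite -fct_sumE.
elim/big_ind2 : _ => //; last by move=> *; exact: straddle_leD.
move=> eps eps0; exists 1 => // u v /andP[uc cv] _ _.
by rewrite /= subrr add0r mulr_ge0// ?(ltW eps0)// subr_ge0 (le_trans uc).
Qed.

Lemma is_derive1_approx (R : realType) (f : R -> R) (c w : R) :
  is_derive c 1 (f : R^o -> R^o) w ->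
  forall eps, 0 < eps -> exists2 e, 0 < e & forall z, `|z - c| < e ->
    `|f z - f c - w * (z - c)| <= eps * `|z - c|.
Proof.
move=> [df fw] eps eps0.
have : (fun h => h^-1 *: (f (h *: 1 + c) - f c)) @ 0^' --> w by rewrite -fw.
move/cvgrPdist_le => /(_ _ eps0)[e /= e0 he].
exists e => // z zc.
have [->|zNc] := eqVneq z c; first by rewrite !subrr mulr0 subrr normr0 mulr0.
have zc0 : z - c != 0 by rewrite subr_eq0.
have := he (z - c); rewrite /= sub0r normrN => /(_ zc zc0).
rewrite /GRing.scale/= mulr1 subrK => h.
have zc_gt0 : 0 < `|z - c| by rewrite normr_gt0.
rewrite -(ler_pM2r zc_gt0) -normrM in h.
rewrite distrC; move: h; congr (`| _ | <= _).
by rewrite mulrBl mulrAC mulVf// mul1r; ring.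
Qed.

Lemma is_derive_straddle_le (R : realType) (f : R -> R) (c w : R) :
  is_derive c 1 (f : R^o -> R^o) w -> straddle_le f c w.
Proof.
move=> /is_derive1_approx dfw eps /dfw[e e0 h].
exists e => // u v /andP[uc cv] cu vc.
have := h u; have := h v.
rewrite (ger0_norm (_ : 0 <= v - c)) ?subr_ge0//.
rewrite (ler0_norm (_ : u - c <= 0)) ?subr_le0//.
move=> /(_ ltac:(lra)); rewrite ler_norml => /andP[_ h1].
move=> /(_ ltac:(lra)); rewrite ler_norml => /andP[h2 _].
lra.
Qed.

(** The growth rate of [|f|] at [c]: the derivative of [f] up to the sign of
[f c] if [f c] is nonzero, and at a zero of [f] the absolute value of that
derivative (to the left of the zero [|f|] can only decrease to 0). *)
Lemma is_derive_straddle_le_norm (R : realType) (f : R -> R) (c w m : R) :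
  is_derive c 1 (f : R^o -> R^o) w ->
  Num.sg (f c) * w <= m -> (f c = 0 -> `|w| <= m) ->
  straddle_le (fun t => `|f t|) c m.
Proof.
move=> dfw swm wm; have [fc0|fcN0] := eqVneq (f c) 0.
  move=> eps eps0; have [e e0 h] := is_derive1_approx dfw eps0.
  exists e => // u v /andP[uc cv] cu vc.
  have := h v; rewrite fc0 subr0 (ger0_norm (_ : 0 <= v - c)) ?subr_ge0//.
  move=> /(_ ltac:(lra)) fv.
  have : `|f v| <= `|f v - w * (v - c)| + `|w| * (v - c).
    have -> : `|w| * (v - c) = `|w * (v - c)|.
      by rewrite normrM (ger0_norm (_ : 0 <= v - c)) ?subr_ge0.
    by rewrite -[X in `|X| <= _](subrK (w * (v - c))) ler_normD.
  move=> fv'; have fu0 := normr_ge0 (f u); have w0 := normr_ge0 w.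
  have h1 : 0 <= (m - `|w|) * (v - c) by rewrite mulr_ge0 ?subr_ge0 ?wm.
  have h2 : 0 <= (m + eps) * (c - u).
    by rewrite mulr_ge0 ?subr_ge0// addr_ge0 ?(ltW eps0)// (le_trans w0) ?wm.
  lra.
(* If [f c] is nonzero, then [|f|] is [Num.sg (f c) * f] near [c]. *)
have sf : straddle_le (fun t => Num.sg (f c) * f t) c m.
  by apply: straddle_leW swm _; apply: is_derive_straddle_le.
have cf : {for c, continuous f}.
  apply: differentiable_continuous; apply/derivable1_diffP.
  by case: dfw.
move=> eps /sf[e e0 h].
have [e' e'0 he'] : exists2 e', 0 < e' & forall z, `|z - c| < e' ->
    Num.sg (f c) * f z >= 0.
  have /cvgrPdist_lt /(_ `|f c|) := cf; rewrite normr_gt0 => /(_ fcN0).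
  move=> [e' /= e'0 he']; exists e' => // z; rewrite distrC => /he'/=.
  have [fc|fc|fc] := sgrP (f c); rewrite ?mul0r// ltr_norml => /andP[]; lra.
exists (Num.min e e') => [|u v ucv]; first by rewrite lt_min e0.
rewrite ltrBlDr -ltrBlDl lt_min => /andP[h1 h2].
rewrite -ltrBlDl lt_min => /andP[h3 h4] /=.
apply: le_trans (h u v ucv ltac:(lra) ltac:(lra)).
(* The equality of the two is needed at [v] only: at [u] the inequality
   [Num.sg (f c) * f u <= |f u|] suffices. *)
have sg1 : `|Num.sg (f c)| = 1 by rewrite normr_sg fcN0.
rewrite -[`|f v|]mul1r -[`|f u|]mul1r -sg1 -!normrM.
apply: lerB; last exact: ler_norm.
rewrite ger0_norm// he'//; move: ucv => /andP[uc cv].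
by rewrite ger0_norm ?subr_ge0.
Qed.

(** * Absolutely continuous functions *)

Lemma absolutely_continuousS (R : realType) (a b c e : R) (f : R -> R) :
  a <= c -> e <= b -> absolutely_continuous a b f ->
  absolutely_continuous c e f.
Proof.
move=> ac eb acf eps /acf[del del0 h]; exists del => // n u v uv.
apply: h => k; have [cu [uvk ve]] := uv k.
by split; [exact: le_trans cu | split => //; exact: le_trans eb].
Qed.

Lemma absolutely_continuous_dominated (R : realType) (a b : R)
    (f g h : R -> R) :
  (forall u v, `|h v - h u| <= `|f v - f u| + `|g v - g u|) ->
  absolutely_continuous a b f -> absolutely_continuous a b g ->
  absolutely_continuous a b h.
Proof.
move=> hfg acf acg e e0; have e2 : 0 < e / 2 by rewrite divr_gt0.
have [d1 d10 h1] := acf _ e2; have [d2 d20 h2] := acg _ e2.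
exists (Num.min d1 d2) => [|n u v uv tuv]; first by rewrite lt_min d10.
rewrite lt_min => /andP[/(h1 _ _ _ uv tuv) fuv /(h2 _ _ _ uv tuv) guv].
rewrite (splitr e); apply: le_lt_trans (ltrD fuv guv).
by rewrite -big_split; apply: ler_sum.
Qed.

Lemma absolutely_continuous_norm (R : realType) (a b : R) (f : R -> R) :
  absolutely_continuous a b f -> absolutely_continuous a b (fun t => `|f t|).
Proof.
move=> acf; apply: (absolutely_continuous_dominated _ acf acf) => u v.
by rewrite (le_trans (ler_dist_dist _ _))// lerDl.
Qed.

Lemma absolutely_continuousB (R : realType) (a b : R) (f g : R -> R) :
  absolutely_continuous a b f -> absolutely_continuous a b g ->
  absolutely_continuous a b (fun t => f t - g t).
Proof.
apply: absolutely_continuous_dominated => u v.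
have -> : f v - g v - (f u - g u) = (f v - f u) - (g v - g u) by ring.
exact: ler_normB.
Qed.

Lemma absolutely_continuous_sum (R : realType) (a b : R) (I : finType)
    (f : I -> R -> R) :
  (forall i, absolutely_continuous a b (f i)) ->
  absolutely_continuous a b (fun t => \sum_i f i t).
Proof.
move=> acf; rewrite -fct_sumE; apply: big_ind => //.
  move=> e e0; exists 1 => // n u v _ _ _.
  by rewrite big1// => k _; rewrite subrr normr0.
move=> g h acg ach.
apply: (absolutely_continuous_dominated _ acg ach) => u v /=.
have -> : g v + h v - (g u + h u) = (g v - g u) + (h v - h u) by ring.
exact: ler_normD.
Qed.

(** * Integration of an almost everywhere growth rate *)

Lemma negligible_open_cover (R : realType) (E : set R) (del : R) :
  (@lebesgue_measure R).-negligible E -> 0 < del ->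
  exists U : set R, [/\ open U, E `<=` U & (lebesgue_measure U < del%:E)%E].
Proof.
move=> [A [mA A0 EA]] del0.
have [|||U [oU AU UA]] := @lebesgue_regularity_outer R A del => //.
  by rewrite [X in (X < _)%E]A0.
exists U; split => //; first exact: subset_trans AU.
have mU : measurable U by exact: open_measurable.
rewrite -(setDUK AU) (le_lt_trans (measureU2 _ _ _))//; first exact: measurableD.
by rewrite [X in (X + _)%E]A0 add0e.
Qed.

Lemma sum_itv_length_le (R : realType) (U : set R) (n : nat) (u v : 'I_n -> R) :
  measurable U -> (forall k, u k <= v k) ->
  (forall k, `]u k, v k[ `<=` U) ->
  trivIset setT (fun k => `]u k, v k[%classic : set R) ->
  ((\sum_k (v k - u k))%:E <= lebesgue_measure U)%E.
Proof.
move=> mU uv subU tuv.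
have -> : ((\sum_k (v k - u k))%:E =
    \sum_k lebesgue_measure (`]u k, v k[%classic : set R))%E.
  rewrite -sumEFin; apply: eq_bigr => k _.
  rewrite lebesgue_measure_itv/= lte_fin; case: ltP => // vu.
  by congr EFin; apply/eqP; rewrite subr_eq0 eq_le vu uv.
rewrite -(@measure_bigsetU_ord _ _ _ (@lebesgue_measure R) n xpredT)//.
apply: le_measure; rewrite ?inE//; first exact: bigsetU_measurable.
apply: (big_ind (fun A => A `<=` U)) => // A B AU BU.
by rewrite subUset.
Qed.

(** A comparison principle with an exceptional null set [E]: there, nothing is
required of the growth of [f]. *)
Lemma absolutely_continuous_le (R : realType) (a b : R) (f G : R -> R)
    (E : set R) :
  a <= b -> absolutely_continuous a b f ->
  (forall u v, a <= u -> u <= v -> v <= b -> G u <= G v) ->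
  (@lebesgue_measure R).-negligible E ->
  (forall c, a <= c <= b -> ~ E c -> straddle_le (f \- G) c 0) ->
  f b - f a <= G b - G a.
Proof.
move=> ab acf ndG negE strad; apply/ler_addgt0Pr => eps eps0.
pose eta := eps / (b - a + 1).
have ba0 : 0 <= b - a by rewrite subr_ge0.
have ba1 : 0 < b - a + 1 by rewrite ltr_wpDl.
have eta0 : 0 < eta by rewrite divr_gt0.
have -> : eps = eta * (b - a) + eta.
  by rewrite -[X in _ + X]mulr1 -mulrDr divfK// gt_eqF.
have [del del0 hdel] := acf _ eta0.
have [U [oU EU Udel]] := negligible_open_cover negE del0.
(* [Q w]: on [a, w], the function [f] grows by no more than [G], up to a slope
   [eta] and the variation of [f] over finitely many disjoint intervals that
   lie in [U]. *)
pose Q w := exists (n : nat) (u v : 'I_n -> R),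
  [/\ forall k, [/\ a <= u k, u k <= v k & v k <= w],
      forall k, `]u k, v k[ `<=` U,
      trivIset setT (fun k => `]u k, v k[%classic : set R) &
      f w - f a <= G w - G a + eta * (w - a) + \sum_k `|f (v k) - f (u k)|].
pose L u v := f v - f u <= G v - G u + eta * (v - u) \/ `]u, v[ `<=` U.
(* The intervals in [U] have total length less than [del]. *)
have [] : Q b; last first.
  move=> n [u [v [uv subU tuv fb]]].
  have lt_eta : \sum_k `|f (v k) - f (u k)| < eta.
    apply: hdel => [k||]; [by have [] := uv k | exact: tuv |].
    rewrite -lte_fin; apply: le_lt_trans Udel.
    apply: sum_itv_length_le => //; first exact: open_measurable.
    by move=> k; have [] := uv k.
  lra.
apply: (@segment_straddle_ind R a b Q L ab).
- exists 0, (fun=> a), (fun=> a); split; [by case | by case | |].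
    by move=> [].
  by rewrite big_ord0 !subrr mulr0 !addr0.
(* The interval ]w, z[ is appended to the family when it lies in [U]. *)
- move=> w z aw wz zb [n [u [v [uv subU tuv fw]]]] [fz|wzU].
    exists n, u, v; split => //; last by lra.
    by move=> k; have [? ? vw] := uv k; split => //; exact: le_trans wz.
  pose u' (k : 'I_n.+1) := if unlift ord_max k is Some j then u j else w.
  pose v' (k : 'I_n.+1) := if unlift ord_max k is Some j then v j else z.
  exists n.+1, u', v'; split.
  + move=> k; rewrite /u' /v'; case: unliftP => [j _|_]; last by [].
    by have [? ? vw] := uv j; split => //; exact: le_trans wz.
  + by move=> k; rewrite /u' /v'; case: unliftP.
  + apply/trivIsetP => i j _ _; rewrite /u' /v'.
    have disj k : `]u k, v k[ `&` `]w, z[ = set0.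
      rewrite -subset0 => y []; rewrite /= !in_itv/= => /andP[_ yv] /andP[wy _].
      have [_ _ vw] := uv k; have := lt_le_trans yv vw.
      by rewrite ltNge ltW.
    case: unliftP => [i' ->|->]; case: unliftP => [j' ->|->] ij.
    * move/trivIsetP : tuv; apply => //.
      by apply: contra ij => /eqP ->.
    * exact: disj.
    * by rewrite setIC.
    * by rewrite eqxx in ij.
  + rewrite big_ord_recr/=.
    rewrite (eq_bigr (fun k => `|f (v k) - f (u k)|)); last first.
      move=> k _; rewrite /u' /v'.
      have -> : widen_ord (leqnSn n) k = lift ord_max k.
        by apply: val_inj; rewrite /= /bump leqNgt ltn_ord.
      by rewrite liftK.
    rewrite /u' /v' unlift_none.
    have := ler_norm (f z - f w); have := ndG _ _ aw wz zb.
    have : 0 <= eta * (z - w) by rewrite mulr_ge0 ?(ltW eta0)// subr_ge0.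
    move=> *; lra.
- move=> c acb; have [Ec|nEc] := pselect (E c).
    have /nbhs_ballP[e /= e0 he] : nbhs c U.
      by apply: open_nbhs_nbhs; split; [exact: oU | exact: EU].
    exists e => // u v _ _ cu vc; right => y.
    rewrite /= in_itv/= => /andP[uy yv].
    apply: he; rewrite /ball/= ltr_distl; apply/andP; split; lra.
  have [e e0 he] := strad c acb nEc eta eta0.
  exists e => // u v /andP[au uc] /andP[cv vb] cu vc; left.
  by have := he u v; rewrite uc cv => /(_ isT cu vc)/=; lra.
Qed.

(** An absolutely continuous function whose growth rate is almost everywhere
at most [g] grows by at most the integral of [g]. *)
Lemma absolutely_continuous_le_integral (R : realType) (a b : R)
    (f g : R -> R) :
  a <= b -> absolutely_continuous a b f ->
  (forall c, a <= c <= b -> 0 <= g c) ->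
  (@lebesgue_measure R).-integrable `[a, b] (EFin \o g) ->
  {ae @lebesgue_measure R, forall c, c \in `]a, b[ -> straddle_le f c (g c)} ->
  ((f b - f a)%:E <= \int[@lebesgue_measure R]_(r in `[a, b]) (g r)%:E)%E.
Proof.
move=> ab acf g0 intg aef.
(* Extended by 0 outside [a, b], [g] is integrable on the whole line. *)
pose h := g \_ `[a, b].
have h0 r : 0 <= h r.
  by rewrite /h patchE; case: ifPn => //; rewrite inE/= in_itv/= => /g0.
have inth : (@lebesgue_measure R).-integrable setT (EFin \o h).
  by move: intg; rewrite integrable_mkcond// restrict_EFin.
have inthS A : measurable A -> (@lebesgue_measure R).-integrable A (EFin \o h).
  by move=> mA; apply: integrableS inth.
pose H w := (\int[@lebesgue_measure R]_(r in `[a, w]) h r)%R.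
have Hnd u v : a <= u -> u <= v -> v <= b -> H u <= H v.
  move=> au uv vb; apply: fine_le.
  - by apply: integrable_fin_num => //; exact: inthS.
  - by apply: integrable_fin_num => //; exact: inthS.
  apply: ge0_subset_integral => //.
  - by have /integrableP[] := inthS _ (measurable_itv `[a, v]).
  - by move=> r _; rewrite lee_fin.
  - by apply: subset_itvl; rewrite bnd_simp.
have Hb : (\int[@lebesgue_measure R]_(r in `[a, b]) (g r)%:E)%E = (H b - H a)%:E.
  have -> : H a = 0 by rewrite /H set_itv1 Rintegral_set1.
  rewrite subr0 fineK; last by apply: integrable_fin_num => //; exact: inthS.
  by apply: eq_integral => r rab; rewrite /h patchE rab.
have FTC : {ae @lebesgue_measure R, forall c, (a%:E < c%:E)%E ->
    derivable H c 1 /\ derive1 H c = h c}.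
  have loch : locally_integrable setT h by exact: integrable_locally.
  exact: (@FTC1 R h (BLeft a) (fun y => inthS _ (measurable_itv _)) loch).
rewrite Hb lee_fin.
(* The endpoints join the exceptional set, as the rate of [f] is only assumed
   on the open interval, and that of [H] is only known to the right of [a]. *)
have negab : (@lebesgue_measure R).-negligible [set a; b].
  apply: negligibleU; apply/negligibleP => //; exact: lebesgue_measure_set1.
apply: (absolutely_continuous_le ab acf Hnd
  (negligibleU negab (negligibleU aef FTC))).
move=> c /andP[ac cb] nE.
have ca : c != a by apply/eqP => ca; apply: nE; left; left.
have cNb : c != b by apply/eqP => cb'; apply: nE; left; right.
have cab : c \in `]a, b[ by rewrite in_itv/= !lt_neqAle eq_sym ca ac cNb cb.
have fc : straddle_le f c (g c).
  by apply: contrapT => nf; apply: nE; right; left => /(_ cab).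
have [dH Hc] : derivable H c 1 /\ derive1 H c = h c.
  apply: contrapT => nf; apply: nE; right; right => F; apply: nf; apply: F.
  by rewrite lte_fin lt_neqAle eq_sym ca.
rewrite -(subrr (g c)).
apply: (straddle_leD fc); apply: is_derive_straddle_le.
apply: is_deriveN; rewrite (_ : g c = h c); last first.
  by rewrite /h patchE mem_set//= in_itv/= ac.
by apply: DeriveDef; rewrite // -derive1E.
Qed.

(** * Contraction in the free-flow region *)

Lemma free_flow_outflow (R : realType) (N : network) (d s : cell N -> R -> R)
    (C alpha : cell N -> R) (P : cell N -> cell N -> R) (x : cell N -> R) i :
  free_flow d s C alpha P x ->
  outflow d s C alpha P x i = controlled_demand d C alpha x i.
Proof.
move=> [_ free]; rewrite /outflow; case: ifP => // _.
suff -> : fifo_factor d s C alpha P x i = 1 by rewrite mul1r.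
(* Free flow means that the factor 1 already satisfies all the constraints. *)
rewrite /fifo_factor; set A := (X in sup X).
have A1 : A 1 by split=> [|k _]; rewrite ?mul1r ?ler01 ?lexx.
have ubA : ubound A 1 by move=> c [/andP[]].
apply/eqP; rewrite eq_le; apply/andP; split.
  by apply: ge_sup ubA; exists 1.
by apply: ub_le_sup A1; exists 1.
Qed.

Lemma controlled_demand_homo (R : realType) (N : network)
    (d : cell N -> R -> R) (C alpha : cell N -> R) (x y : cell N -> R) i :
  demand_function (d i) -> 0 <= alpha i -> 0 <= x i -> x i <= y i ->
  controlled_demand d C alpha x i <= controlled_demand d C alpha y i.
Proof.
move=> [_ _ dhomo _ _] a0 xi0 xy; rewrite /controlled_demand.
have dxy : d i (x i) <= d i (y i).
  by apply: dhomo => //; rewrite in_itv/= ?xi0// (le_trans xi0).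
by case: ifP => _; apply: le_min2; rewrite ?lexx// ler_wpM2l.
Qed.

(** The row of [P] at a cell sums to 1, except that it vanishes at a sink: no
link leaves a sink, whose head is the external world. *)
Lemma routing_sum_le (R : realType) (N : network) (P : cell N -> cell N -> R)
    (w : cell N -> R) :
  routing_matrix P -> (forall i, 0 <= w i) ->
  \sum_i \sum_j P j i * w j <= \sum_i w i.
Proof.
move=> [_ P0 P1] w0; rewrite exchange_big/=; apply: ler_sum => j _.
rewrite -mulr_suml; have [sj|sj] := boolP (sink j); last by rewrite P1// mul1r.
rewrite big1 ?mul0r// => k _; apply: P0; rewrite /linked.
by rewrite (eqP sj) eq_sym andbN.
Qed.

(** The rate of [|y|] for one cell, where [y] has derivative [l + p - z]: the
outflow difference [z], which never has the sign opposite to that of [y],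
contributes [- |z|]. *)
Lemma cell_rate_le (R : realType) (y z l p q : R) :
  0 <= q -> `|p| <= q -> 0 <= y * z -> (y = 0 -> z = 0) ->
  Num.sg y * (l + p - z) <= `|l| + q - `|z| /\
  (y = 0 -> `|l + p - z| <= `|l| + q - `|z|).
Proof.
move=> q0 pq yz y0; split; last first.
  move=> /y0 ->; rewrite !(subr0, normr0).
  by rewrite (le_trans (ler_normD _ _))// lerD2l.
have := ler_norm l; have := ler_norm (- l); have := ler_norm p.
have := ler_norm (- p); rewrite !normrN => p1 p2 l1 l2.
have [y00|y_gt0|y_lt0] := sgrP y.
- by rewrite mul0r (y0 y00) normr0 subr0 addr_ge0.
- by rewrite pmulr_rge0 // in yz; rewrite (ger0_norm yz); lra.
- by rewrite nmulr_rge0 // in yz; rewrite (ler0_norm yz); lra.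
Qed.

(** The rate of change [w] of [x' i - x i], for two free-flow states whose
inflows differ by [l], satisfies the two bounds under which [|x' i - x i|]
grows at rate at most [m i]; these rates add up to at most [norm1 l]. *)
Lemma free_flow_contraction (R : realType) (N : network)
    (d s : cell N -> R -> R) (C alpha : cell N -> R)
    (P : cell N -> cell N -> R) (x x' l : cell N -> R) :
  (forall i, demand_function (d i)) -> (forall i, 0 <= alpha i) ->
  routing_matrix P ->
  free_flow d s C alpha P x -> free_flow d s C alpha P x' ->
  exists2 m : cell N -> R, \sum_i m i <= norm1 l &
    forall i, let w := l i + (net_flow d s C alpha P x' i -
                              net_flow d s C alpha P x i) in
      Num.sg (x' i - x i) * w <= m i /\ (x' i - x i = 0 -> `|w| <= m i).
Proof.
move=> hd a0 hP fx fx'.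
pose z i := controlled_demand d C alpha x' i - controlled_demand d C alpha x i.
exists (fun i => `|l i| + \sum_j P j i * `|z j| - `|z i|).
  rewrite sumrB big_split/= -addrA gerDl subr_le0.
  by apply: routing_sum_le => // i; exact: normr_ge0.
move=> i w.
have -> : w = l i + \sum_j P j i * z j - z i.
  rewrite /w /net_flow -[RHS]addrA; congr (_ + _).
  have net y : free_flow d s C alpha P y ->
      \sum_j P j i * outflow d s C alpha P y j =
      \sum_j P j i * controlled_demand d C alpha y j.
    by move=> fy; apply: eq_bigr => j _; rewrite free_flow_outflow.
  rewrite !net// !free_flow_outflow//.
  have -> : \sum_j P j i * z j =
      \sum_j P j i * controlled_demand d C alpha x' j -
      \sum_j P j i * controlled_demand d C alpha x j.
    by rewrite -sumrB; apply: eq_bigr => j _; rewrite -mulrBr.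
  by rewrite /z; ring.
have [P_ge0 _ _] := hP.
apply: cell_rate_le.
- by apply: sumr_ge0 => j _; rewrite mulr_ge0.
- apply: le_trans (ler_norm_sum _ _ _) _; apply: ler_sum => j _.
  by rewrite normrM ger0_norm.
- have [xx'|x'x] := leP (x i) (x' i).
    by rewrite mulr_ge0// subr_ge0// controlled_demand_homo//; exact: fx.1.
  rewrite mulr_le0// subr_le0 ?(ltW x'x)//.
  by rewrite controlled_demand_homo ?(ltW x'x)//; exact: fx'.1.
- by move=> /subr0_eq xx'; rewrite /z /controlled_demand xx' subrr.
Qed.

Lemma measurable_norm1B (R : realType) (N : network) (D : set R)
    (lam lam' : R -> cell N -> R) :
  (forall i, measurable_fun D (lam ^~ i)) ->
  (forall i, measurable_fun D (lam' ^~ i)) ->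
  measurable_fun D (fun r => norm1 (lam' r \- lam r)).
Proof.
move=> mlam mlam'; apply: measurable_sum => i.
by apply: measurableT_comp => //; exact: measurable_funB.
Qed.

(** * Stability of the trajectories *)

Theorem proposition3 (R : realType) (N : network) (T : R) (hT : 0 <= T)
  (d s : cell N -> R -> R)
  (hd : forall i, demand_function (d i))
  (hs : forall i, ~~ source i -> supply_function (s i))
  (C alpha : R -> cell N -> R) (P : R -> cell N -> cell N -> R)
  (hC : forall (t : R) i, t \in `[0, T] -> 0 <= C t i)
  (halpha : forall (t : R) i, t \in `[0, T] -> 0 <= alpha t i <= 1)
  (hP : forall t : R, t \in `[0, T] -> routing_matrix (P t))
  (x0 x0' : cell N -> R) (lam lam' x x' : R -> cell N -> R)
  (hx0 : forall i, 0 <= x0 i) (hx0' : forall i, 0 <= x0' i)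
  (hlam : inflow_function T lam) (hlam' : inflow_function T lam')
  (hx : trajectory T d s C alpha P x0 lam x)
  (hx' : trajectory T d s C alpha P x0' lam' x')
  (hfree : forall t : R, t \in `[0, T] ->
     free_flow d s (C t) (alpha t) (P t) (x t))
  (hfree' : forall t : R, t \in `[0, T] ->
     free_flow d s (C t) (alpha t) (P t) (x' t)) :
  forall t : R, t \in `[0, T] ->
    ((norm1 (x' t \- x t)%R)%:E <=
       (norm1 (x0' \- x0)%R)%:E + norm1_upto t (fun r => (lam' r \- lam r)%R))%E.
Proof.
move=> t; rewrite in_itv/= => /andP[t0 tT].
pose g r := norm1 (lam' r \- lam r).
have g0 r : 0 <= g r by apply: sumr_ge0 => i _.
have mg : measurable_fun (`[0, t]%classic : set R) g.
  have sub : (`[0, t] `<=` `[0, T])%classic.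
    by apply: subset_itvl; rewrite bnd_simp.
  have [mlam _ _] := hlam; have [mlam' _ _] := hlam'.
  by apply: measurable_norm1B => i; apply: measurable_funS sub _.
have [intg|] := pselect ((@lebesgue_measure R).-integrable `[0, t] (EFin \o g));
    last first.
  move=> nintg; suff -> : norm1_upto t (fun r => lam' r \- lam r) = +oo%E.
    by rewrite addey// leey.
  apply/eqP; rewrite -leye_eq leNgt; apply/negP => fing; apply: nintg.
  apply/integrableP; split; first exact/measurable_EFinP.
  by under eq_integral do rewrite /= ger0_norm//.
rewrite -leeBlDl// -EFinB.
have -> : norm1 (x' t \- x t) - norm1 (x0' \- x0) =
    norm1 (x' t \- x t) - norm1 (x' 0 \- x 0).
  congr (_ - _); apply: eq_bigr => i _ /=.
  by have [_ _ ->] := hx i; have [_ _ ->] := hx' i.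
apply: (@absolutely_continuous_le_integral R 0 t
  (fun r => norm1 (x' r \- x r)) g) => //.
  apply: absolutely_continuous_sum => i; apply: absolutely_continuous_norm.
  apply: (@absolutely_continuousS _ 0 T) => //.
  by apply: absolutely_continuousB; [have [] := hx' i | have [] := hx i].
have aeF : Filter (nbhs (almost_everywhere (@lebesgue_measure R))).
  exact: ae_filter_ringOfSetsType.
have ae_der : {ae @lebesgue_measure R, forall r, forall i, r \in `]0, t[ ->
    is_derive r 1 (x ^~ i : R^o -> R^o)
      (lam r i + net_flow d s (C r) (alpha r) (P r) (x r) i) /\
    is_derive r 1 (x' ^~ i : R^o -> R^o)
      (lam' r i + net_flow d s (C r) (alpha r) (P r) (x' r) i)}.
  apply: filter_forall => i.
  have [_ dx _] := hx i; have [_ dx' _] := hx' i.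
  apply: filterS2 dx dx' => r dxr dx'r rt.
  have rT : r \in `]0, T[ by apply: subset_itvl rt; rewrite bnd_simp.
  by split; [exact: dxr | exact: dx'r].
apply: filterS ae_der => r der rt.
have rT : r \in `[0, T].
  by move: rt; rewrite !in_itv/= => /andP[/ltW -> /ltW /le_trans ->].
have [m mg' hm] := @free_flow_contraction R N d s (C r) (alpha r) (P r)
  (x r) (x' r) (lam' r \- lam r) hd
  (fun i => proj1 (andP (halpha r i rT))) (hP r rT) (hfree r rT) (hfree' r rT).
apply: straddle_leW mg' _; apply: straddle_le_sum => i.
have [dx dx'] := der i rt; have [h1 h2] := hm i.
apply: (@is_derive_straddle_le_norm R (fun q => x' q i - x q i) r _ _ _ h1 h2).
rewrite /= addrACA -opprD.
exact: (is_deriveB dx' dx).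
Qed.
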